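(* Let $p$ be a prime number and let $a$ be an integer that is not a multiple of $p$. Then for every positive integer $n$, $$ \vartheta_p\left(\sum_{k = 1}^{n} \left(\frac{1}{a^k} + \frac{1}{(p - a)^k} + \frac{k H_{k - 1}}{a^k}\right) \frac{p^k}{k^2}\right) \geq n + 1 - 2 \left\lfloor\log_p(n)\right\rfloor . $$
   Context: For a prime $p$ and a nonzero rational number $r$, $\vartheta_p(r)$ denotes the usual $p$-adic valuation of $r$; by convention $\vartheta_p(0) = +\infty$. The harmonic numbers are $H_0 = 0$ and $H_m = \frac{1}{1} + \frac{1}{2} + \cdots + \frac{1}{m}$ for every positive integer $m$. For a positive real $x$, $\log_p(x) = \frac{\log x}{\log p}$ is the logarithm to the base $p$, and $\lfloor \cdot \rfloor$ denotes the integer part (floor). *)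

(* Defs.v *)
From mathcomp Require Import all_boot all_order all_algebra.
From mathcomp Require Import constructive_ereal reals exp.

Set Implicit Arguments.
Unset Strict Implicit.
Unset Printing Implicit Defensive.

Import Order.TTheory GRing.Theory Num.Theory.
Local Open Scope ring_scope.

(* [\bar int] is used as the value set ℤ ∪ {+oo}; the value -oo never occurs. *)
Definition padic_val (p : nat) (r : rat) : \bar int :=
  if r == 0 then +oo%E
  else ((logn p `|numq r|%N)%:Z - (logn p `|denq r|%N)%:Z)%:E.

Definition harmonic_number (m : nat) : rat :=
  \sum_(1 <= i < m.+1) (i%:R)^-1.

Definition log_base (R : realType) (p : nat) (x : R) : R := ln x / ln p%:R.

(* Main.v *)
Require Import Defs.
From mathcomp Require Import all_boot all_order all_algebra.
From mathcomp Require Import constructive_ereal reals exp.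
From mathcomp Require Import ring zify.

Set Implicit Arguments.
Unset Strict Implicit.
Unset Printing Implicit Defensive.

Import Order.TTheory GRing.Theory Num.Theory.
Local Open Scope ring_scope.

(** Put [x = p / a] and [z = p / (a - p) = x / (1 - x)].  The statement is a
    truncation of the dilogarithm identity
    [Li2 x + Li2 (- z) + ln (1 - x) ^ 2 / 2 = 0].  Expanding [z ^ k] in powers
    of [x] up to degree [n], the coefficients of [x ^ m] with [m <= n] cancel by
    the identity [\sum_k (-1) ^ k C(m, k) / (k + 1) ^ 2 = H_(m + 1) / (m + 1)],
    so the sum equals [\sum_(k <= n) (-1) ^ k r_k / k ^ 2], where [r_k] is the
    tail of the expansion of [z ^ k].  Each [r_k] is divisible by [p ^ (n + 1)],
    and each [1 / k ^ 2] costs at most [2 * floor (log_p n)]. *)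

(** Membership of [r] in [p ^ N Z_(p)], with [Z_(p)] the localization of the integers at [p].
    Clearing the denominator covers [r = 0] and leaves [v] free to be any multiplier prime to
    [p]. *)
Definition padic_dvd (p N : nat) (r : rat) : Prop :=
  exists u v : int, ~~ (p%:Z %| v)%Z /\ r * v%:~R = u%:~R * p%:R ^+ N.

Section PadicDivisibility.
Variables (p : nat) (p_prime : prime p).

Lemma Euclid_dvdz (u v : int) : (p%:Z %| u * v)%Z = (p%:Z %| u)%Z || (p%:Z %| v)%Z.
Proof. by rewrite !dvdzE abszM Euclid_dvdM. Qed.

Lemma padic_dvdM M N r s :
  padic_dvd p M r -> padic_dvd p N s -> padic_dvd p (M + N) (r * s).
Proof.
move=> [u [v [hv e]]] [u' [v' [hv' e']]]; exists (u * u'), (v * v'); split.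
  by rewrite Euclid_dvdz negb_or hv.
by rewrite !rmorphM exprD /= mulrACA e e' mulrACA.
Qed.

Lemma padic_dvdD N r s :
  padic_dvd p N r -> padic_dvd p N s -> padic_dvd p N (r + s).
Proof.
move=> [u [v [hv e]]] [u' [v' [hv' e']]].
exists (u * v' + u' * v), (v * v'); split.
  by rewrite Euclid_dvdz negb_or hv.
rewrite rmorphD !rmorphM /=.
transitivity (r * v%:~R * v'%:~R + s * v'%:~R * v%:~R); first by ring.
by rewrite e e'; ring.
Qed.

Lemma padic_dvd_int (m : int) : padic_dvd p 0 m%:~R.
Proof.
exists m, 1; rewrite !mulr1; split=> //.
by rewrite dvdzE dvdn1 neq_ltn prime_gt1 ?orbT.
Qed.

Lemma padic_dvd_sum N n (F : nat -> rat) :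
  (forall k, (k < n)%N -> padic_dvd p N (F k)) ->
  padic_dvd p N (\sum_(k < n) F k).
Proof.
move=> h; elim/big_ind: _ => [|r s|k _]; last exact: h.
  by have := padic_dvd_int 0; move=> [u [v [hv _]]]; exists 0, v; rewrite !mul0r.
exact: padic_dvdD.
Qed.

Lemma padic_dvd_divp (v : int) : ~~ (p%:Z %| v)%Z -> padic_dvd p 1 (p%:R / v%:~R).
Proof.
move=> hv; exists 1, v; split=> //.
rewrite mul1r expr1 divfK // intr_eq0.
by apply: contraNneq hv => ->; rewrite dvdz0.
Qed.

Lemma padic_dvd_expdiv e k :
  (0 < k)%N -> (logn p k <= e)%N -> padic_dvd p 0 (p%:R ^+ e / k%:R).
Proof.
move=> k0 le; have [v pv kE] := pfactor_coprime p_prime k0.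
exists (p ^ (e - logn p k))%N%:Z, v%:Z; split.
  by rewrite dvdzE -prime_coprime.
have p0 : p%:R != 0 :> rat by rewrite pnatr_eq0 -lt0n prime_gt0.
have v0 : v%:R != 0 :> rat.
  by rewrite pnatr_eq0 -lt0n; move: k0; rewrite kE muln_gt0 => /andP[].
have -> : k%:R = v%:R * p%:R ^+ logn p k :> rat by rewrite {1}kE natrM natrX.
rewrite -!pmulrn natrX expr0 mulr1 -[in LHS](subnK le) exprD.
by field; rewrite v0 expf_neq0.
Qed.

(** Clearing denominators gives an equality of integers, on which [logn p] is compared; [v]
    contributes 0. The factor [p ^ f] lets a natural exponent [N] express a bound [N - f] that may
    be negative. *)
Lemma padic_val_ge N f r :
  padic_dvd p N (p%:R ^+ f * r) -> ((N%:Z - f%:Z)%:E <= padic_val p r)%E.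
Proof.
move=> [u [v [hv e]]]; rewrite /padic_val; case: eqP => [_|/eqP r0].
  exact: leey.
have p0 := prime_gt0 p_prime.
have d0 : (denq r)%:~R != 0 :> rat by rewrite intr_eq0 denq_neq0.
have eZ : (p%:Z ^+ f * numq r * v) = (u * p%:Z ^+ N * denq r).
  apply: (@intr_inj rat); rewrite !rmorphM !rmorphXn /= -e -{2}[r]divq_num_den.
  by field.
have n0 : numq r != 0 by rewrite numq_eq0.
have v0 : v != 0 by apply: contraNneq hv => ->; rewrite dvdz0.
have u0 : u != 0.
  apply/eqP=> u0; move/eqP: eZ; rewrite u0 !mul0r !mulf_eq0 expf_eq0.
  by rewrite (negPf n0) (negPf v0) -[_ == 0 :> int]/(p == 0)%N eqn0Ngt p0 andbF.
have := congr1 (fun m : int => logn p `|m|%N) eZ.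
rewrite !abszM !abszX /= !lognM ?muln_gt0 ?expn_gt0 ?absz_gt0 ?p0 ?n0 ?v0 ?u0 ?denq_neq0 //.
rewrite !pfactorK //.
have -> : logn p `|v|%N = 0%N.
  by apply: logn_coprime; rewrite prime_coprime // -dvdzE.
by rewrite lee_fin; lia.
Qed.

(** With [x = p / a], the sum truncates the expansion of [(x / (1 - x)) ^ (k + 1)]. By [z = x + x z]
    and Pascal's rule, the tails satisfy [R (n + 1) (k + 1) = x (R n k + R n (k + 1))], so each step
    in [n] gains one factor [x], hence one factor [p]. *)
Lemma padic_dvd_binomial_tail (a : int) (n k : nat) : ~~ (p%:Z %| a)%Z ->
  padic_dvd p n.+1
    ((p%:R / (a - p%:Z)%:~R) ^+ k.+1 -
     \sum_(m < n) 'C(m, k)%:R * (p%:R / a%:~R) ^+ m.+1).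
Proof.
move=> pa; set x : rat := p%:R / a%:~R; set z : rat := p%:R / _.
have pap : ~~ (p%:Z %| a - p%:Z)%Z by rewrite rpredBr.
have hx : padic_dvd p 1 x by apply: padic_dvd_divp.
have hz : padic_dvd p 1 z by apply: padic_dvd_divp.
have zE : z = x + x * z.
  have a0 : a%:~R != 0 :> rat by rewrite intr_eq0; apply: contraNneq pa => ->.
  have ap0 : (a - p%:Z)%:~R != 0 :> rat.
    by rewrite intr_eq0; apply: contraNneq pap => ->.
  rewrite /x /z rmorphB /=; move: ap0; rewrite rmorphB /= => ap0.
  by field; rewrite ap0.
elim: n k => [|n IHn] k.
  rewrite big_ord0 subr0; elim: k => [|k IHk]; first by rewrite expr1.
  (* For [n = 0] a single power of [p] is claimed: the last factor [z] enters only as a [p]-integral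
     number. *)
  rewrite exprSr -[1%N]addn0; apply: padic_dvdM => //.
  case: hz => [u [v [hv e]]]; exists (u * p%:Z), v; split => //.
  by rewrite e rmorphM expr1 expr0 mulr1.
case: k => [|k].
  suff -> : z ^+ 1 - \sum_(m < n.+1) 'C(m, 0)%:R * x ^+ m.+1 =
            x * (z ^+ 1 - \sum_(m < n) 'C(m, 0)%:R * x ^+ m.+1).
    exact: (padic_dvdM hx).
  rewrite big_ord_recl mulrBr mulr_sumr !expr1 {1}zE bin0 mul1r opprD.
  rewrite addrACA subrr add0r; congr (_ - _); apply: eq_bigr => i _.
  by rewrite !bin0 !mul1r exprS.
suff -> : z ^+ k.+2 - \sum_(m < n.+1) 'C(m, k.+1)%:R * x ^+ m.+1 =
   x * ((z ^+ k.+1 - \sum_(m < n) 'C(m, k)%:R * x ^+ m.+1) +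
        (z ^+ k.+2 - \sum_(m < n) 'C(m, k.+1)%:R * x ^+ m.+1)).
  by apply: (padic_dvdM hx); apply: padic_dvdD.
rewrite big_ord_recl mul0r add0r addrACA -opprD -big_split mulrBr mulr_sumr /=.
congr (_ - _).
  by rewrite [LHS]exprS {1}zE !exprS; ring.
by apply: eq_bigr => i _; rewrite binS natrD [x ^+ _.+1]exprS; ring.
Qed.

End PadicDivisibility.

(** Pascal's rule makes the sum telescope to [f 0 - f n], and [f n = 0] because [m < n]. Leaving [n]
    free above [m] lets all [m < n] share one range of [k] when the double sum is exchanged
    later. *)
Lemma sum_alt_bin_succ n m : (m < n)%N ->
  \sum_(k < n) (-1) ^+ k * 'C(m.+1, k.+1)%:R = 1 :> rat.
Proof.
move=> lt; pose f k : rat := (-1) ^+ k * 'C(m, k)%:R.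
rewrite (eq_bigr (fun k : 'I_n => - (f k.+1 - f k))); last first.
  by move=> k _; rewrite /f binS natrD exprS; ring.
rewrite sumrN -(big_mkord xpredT (fun k => f k.+1 - f k)) telescope_sumr //.
by rewrite /f bin0 (bin_small lt) expr0; ring.
Qed.

(** Absorption: [C(m, k) / (k + 1) = C(m + 1, k + 1) / (m + 1)]. *)
Lemma sum_alt_bin_div n m : (m < n)%N ->
  \sum_(k < n) (-1) ^+ k * 'C(m, k)%:R / k.+1%:R = m.+1%:R^-1 :> rat.
Proof.
move=> lt; rewrite -[RHS]mul1r -[X in _ = X * _](sum_alt_bin_succ lt) mulr_suml.
apply: eq_bigr => k _; rewrite -!mulrA; congr (_ * _).
apply/eqP; rewrite eqr_div ?pnatr_eq0 // -!natrM.
by rewrite mulnC mul_bin_diag mulnC.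
Qed.

Lemma harmonic_numberS m :
  harmonic_number m.+1 = harmonic_number m + m.+1%:R^-1.
Proof. by rewrite /harmonic_number big_nat_recr. Qed.

(** By Pascal's rule, passing from [m] to [m + 1] adds the sum of [sum_alt_bin_div], that is
    [1 / (m + 1)]. *)
Lemma harmonic_number_alt_bin n m : (m <= n)%N ->
  \sum_(k < n) (-1) ^+ k * 'C(m, k.+1)%:R / k.+1%:R = harmonic_number m.
Proof.
elim: m => [|m IHm] lt.
  by rewrite /harmonic_number big_geq // big1 // => k _; rewrite mulr0 mul0r.
rewrite harmonic_numberS -IHm 1?ltnW // -(sum_alt_bin_div lt) -big_split /=.
by apply: eq_bigr => k _; rewrite binS natrD; ring.
Qed.

(** Absorption turns one of the two factors [1 / (k + 1)] into [1 / (m + 1)]; what remains is an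
    alternating sum equal to [H_(m + 1)]. *)
Lemma sum_alt_bin_div_sqr n m : (m < n)%N ->
  \sum_(k < n) (-1) ^+ k * 'C(m, k)%:R / k.+1%:R ^+ 2
    = harmonic_number m.+1 / m.+1%:R.
Proof.
move=> lt; rewrite -(harmonic_number_alt_bin lt) mulr_suml.
apply: eq_bigr => k _; rewrite -!mulrA; congr (_ * _).
rewrite expr2 invfM mulrCA [RHS]mulrCA; congr (_ * _).
apply/eqP; rewrite eqr_div ?pnatr_eq0 // -!natrM.
by rewrite mulnC mul_bin_diag mulnC.
Qed.

Lemma logn_le_floor_log (R : realType) (p k n : nat) : prime p ->
  (0 < k <= n)%N -> (logn p k)%:Z <= Num.floor (log_base p (n%:R : R)).
Proof.
move=> pp /andP[k0 kn]; have p1 := prime_gt1 pp.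
have lnp : 0 < ln p%:R :> R by rewrite ln_gt0 // ltr1n.
rewrite floor_ge_int /log_base -pmulrn ler_pdivlMr // mulr_natl -lnXn; last first.
  by rewrite ltr0n prime_gt0.
rewrite -natrX ler_ln ?posrE ?ltr0n ?expn_gt0 ?(leq_trans k0 kn) ?prime_gt0 //.
by rewrite ler_nat (leq_trans _ kn) // dvdn_leq // pfactor_dvdnn.
Qed.

Theorem theorem2p1 (R : realType) (p : nat) (a : int)
    (p_prime : prime p) (p_ndvd_a : ~~ (p%:Z %| a)%Z)
    (n : nat) (n_gt0 : (0 < n)%N) :
  ((n%:Z + 1 - 2 * Num.floor (log_base p (n%:R : R)))%:E <=
   padic_val p
     (\sum_(1 <= k < n.+1)
        ((a%:~R ^+ k)^-1 + ((p%:R - a%:~R) ^+ k)^-1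
         + k%:R * harmonic_number k.-1 / a%:~R ^+ k)
        * (p%:R ^+ k / k%:R ^+ 2)))%E.
Proof.
have fl k := @logn_le_floor_log R p k n p_prime.
(* The case [k = 1] shows that the floor is nonnegative, so it is a natural number [e] and can serve
   as an exponent. *)
have := fl 1%N n_gt0; rewrite logn1.
case E : (Num.floor _) fl => [e|//] fl _.
have -> : n%:Z + 1 - 2 * e%:Z = n.+1%:Z - (e + e)%:Z by lia.
apply: padic_val_ge => //.
rewrite big_add1 big_mkord /=.
set x : rat := p%:R / a%:~R; pose z : rat := p%:R / (a - p%:Z)%:~R.
pose r k := z ^+ k.+1 - \sum_(m < n) 'C(m, k)%:R * x ^+ m.+1.
(* Each of the two factors [1 / (k + 1)] absorbs one [p ^ e] and becomes [p]-integral. *)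
suff -> : p%:R ^+ (e + e) * \sum_(k < n)
        ((a%:~R ^+ k.+1)^-1 + ((p%:R - a%:~R) ^+ k.+1)^-1
         + k.+1%:R * harmonic_number k / a%:~R ^+ k.+1)
        * (p%:R ^+ k.+1 / k.+1%:R ^+ 2) =
   \sum_(k < n) ((-1) ^+ k.+1)%:~R * (p%:R ^+ e / k.+1%:R) *
       (p%:R ^+ e / k.+1%:R) * r k.
  apply: (padic_dvd_sum p_prime (F := fun k => ((-1) ^+ k.+1)%:~R *
    (p%:R ^+ e / k.+1%:R) * (p%:R ^+ e / k.+1%:R) * r k)) => k lt.
  have hk : padic_dvd p 0 (p%:R ^+ e / k.+1%:R).
    by apply: padic_dvd_expdiv => //; rewrite -lez_nat fl.
  apply: (@padic_dvdM _ p_prime 0); last exact: padic_dvd_binomial_tail.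
  apply: (@padic_dvdM _ p_prime 0 0) => //.
  by apply: (@padic_dvdM _ p_prime 0 0) => //; apply: padic_dvd_int.
have Tz : \sum_(k < n) (-1) ^+ k / k.+1%:R ^+ 2 *
    (\sum_(m < n) 'C(m, k)%:R * x ^+ m.+1) =
    \sum_(m < n) harmonic_number m.+1 / m.+1%:R * x ^+ m.+1.
  under eq_bigr do rewrite mulr_sumr.
  rewrite exchange_big; apply: eq_bigr => m _ /=.
  rewrite -(sum_alt_bin_div_sqr (ltn_ord m)) mulr_suml.
  by apply: eq_bigr => k _; ring.
(* Here [p / (p - a) = - z], and the two terms over [a ^ k] merge through
   [1 / k ^ 2 + H_(k - 1) / k = H_k / k]. *)
transitivity (p%:R ^+ (e + e) * (\sum_(k < n) (-1) ^+ k.+1 * z ^+ k.+1 / k.+1%:R ^+ 2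
   + \sum_(m < n) harmonic_number m.+1 / m.+1%:R * x ^+ m.+1)).
  congr (_ * _); rewrite -big_split; apply: eq_bigr => k _ /=.
  have k0 : k.+1%:R != 0 :> rat by rewrite pnatr_eq0.
  have -> : (-1) ^+ k.+1 * z ^+ k.+1 = p%:R ^+ k.+1 * ((p%:R - a%:~R) ^+ k.+1)^-1.
    rewrite -exprVn -!exprMn /z rmorphB /=; congr (_ ^+ _).
    by rewrite -[p%:R - _]opprB invrN; ring.
  rewrite harmonic_numberS /x expr_div_n.
  move: (a%:~R ^+ _)^-1 ((_ - _) ^+ _)^-1 (p%:R ^+ _) => A B P.
  by field; rewrite nat1r.
(* By [Tz], the harmonic part is the sum of the truncated expansions with the opposite sign, so each
   [z ^ (k + 1)] is reduced to its tail [r k]. *)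
rewrite -Tz -big_split mulr_sumr; apply: eq_bigr => k _ /=.
rewrite /r rmorphXn rmorphN /= exprD exprS.
by field; rewrite nat1r pnatr_eq0.
Qed.
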